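(* There exists a numerical constant $C>0$ such that, for all $\varepsilon>0$ and all $\lambda\in\Lambda$, $$\|f_{\lambda^\varepsilon}-f_*\|^2_{L_2(\mu)}+2\varepsilon\sum_{j\notin\mathrm{supp}(\lambda)}\lambda_j^\varepsilon\le 3\|f_\lambda-f_*\|^2_{L_2(\mu)}+C\Bigl(\varepsilon^2\alpha_N^2(\lambda)+\frac{\varepsilon}{N}\Bigr).$$
   Context: Density estimation setting. $P$ is a probability distribution on a measurable space $(S,\mathcal A)$ having a density $f_*$ with respect to a $\sigma$-finite measure $\mu$ on $(S,\mathcal A)$, and $f_*$ is uniformly bounded by a constant $M$; $Pg=\int g\,dP$. The dictionary $h_1,\dots,h_N$ consists of probability densities with respect to $\mu$ that are uniformly bounded by $1$. $\Lambda=\{(\lambda_1,\dots,\lambda_N):\lambda_j\ge0,\ \sum_{j=1}^N\lambda_j=1\}$ and $f_\lambda=\sum_{j=1}^N\lambda_jh_j$ for $\lambda\in\mathbb R^N$; $\mathrm{supp}(\lambda)=\{j:\lambda_j\ne0\}$. Penalized true risk minimizer (with $0\log0=0$): $$\lambda^\varepsilon:=\operatorname*{argmin}_{\lambda\in\Lambda}\Bigl[\|f_\lambda\|^2_{L_2(\mu)}-2Pf_\lambda+\varepsilon\sum_{j=1}^N\lambda_j\log\lambda_j\Bigr].$$ Alignment coefficient. For $\lambda\in\Lambda$, let $T_\Lambda(\lambda):=\{v\in\mathbb R^N:\exists t>0,\ \lambda+vt\in\Lambda\}$ (the tangent cone of the convex set $\Lambda$ at $\lambda$). For $w\in\mathbb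 R^N$, $$a_H(\Lambda,\lambda,w):=\sup\{\langle w,u\rangle_{\ell_2}:\ u\in T_\Lambda(\lambda),\ \|f_u\|_{L_2(\mu)}=1\}$$ (the subscript $H$ is only part of the notation). Let $s^N(\lambda)\in\mathbb R^N$ have coordinates $s^N_j(\lambda):=\log(eN^2\lambda_j)$ for $j\in\mathrm{supp}(\lambda)$ and $s^N_j(\lambda):=0$ for $j\notin\mathrm{supp}(\lambda)$. Then $\alpha_N(\lambda):=a_H(\Lambda,\lambda,s^N(\lambda))$.
   Formalization: In α_N the supremum is over u in −T_Λ(λ) instead of u in T_Λ(λ): as printed the bound fails for λ=e_1 when the dictionary has many copies of h_1=f_*; a supremum over the empty set is −∞, so then α_N²=+∞. *)

(* Defs.v *)
From HB Require Import structures.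
From mathcomp Require Import all_boot all_order all_algebra.
From mathcomp Require Import all_classical all_reals all_analysis.

Set Implicit Arguments.
Unset Strict Implicit.
Unset Printing Implicit Defensive.
Import Order.TTheory GRing.Theory Num.Theory.
Import numFieldNormedType.Exports.

Local Open Scope classical_set_scope.
Local Open Scope ring_scope.

Section Coordinates.
Variables (R : realType) (N : nat).
Implicit Types (lam u v w : 'rV[R]_N) (Lam : set 'rV[R]_N).

Definition simplex : set 'rV[R]_N :=
  [set lam | (forall j, 0 <= lam 0 j) /\ \sum_(j < N) lam 0 j = 1].

Definition supp lam : {pred 'I_N} := [pred j | lam 0 j != 0].

Definition dotp w u : R := \sum_(j < N) w 0 j * u 0 j.

(* Since [ln 0 = 0], the convention 0 log 0 = 0 holds. *)
Definition neg_entropy lam : R := \sum_(j < N) lam 0 j * ln (lam 0 j).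

Definition tangent_cone Lam lam : set 'rV[R]_N :=
  [set v | exists2 t : R, 0 < t & Lam (lam + t *: v)].

Definition sN lam : 'rV[R]_N :=
  \row_j (if j \in supp lam
          then ln (expR 1 * N%:R ^+ 2 * lam 0 j) else 0).

Definition argmin (F : 'rV[R]_N -> \bar R) Lam : set 'rV[R]_N :=
  [set lam | Lam lam /\ forall lam', Lam lam' -> (F lam <= F lam')%E].

End Coordinates.
Arguments simplex {R N}.

Section Densities.
Context {d : measure_display} {S : measurableType d} {R : realType}.
Variable mu : {measure set S -> \bar R}.
Local Open Scope ereal_scope.

Definition L2norm (g : S -> R) : \bar R := 'N[mu]_(2%:E)[EFin \o g].

Definition is_density (f : S -> R) : Prop :=
  [/\ measurable_fun setT f, forall x, (0 <= f x)%R &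
      \int[mu]_x (f x)%:E = 1].

Definition has_density (P : probability S R) (f : S -> R) : Prop :=
  is_density f /\
  forall A, measurable A -> P A = \int[mu]_(x in A) (f x)%:E.

Section Dictionary.
Variables (N : nat) (h : 'I_N -> S -> R).
Implicit Types (lam u w : 'rV[R]_N).

Definition mixture lam : S -> R := fun x => (\sum_(j < N) lam 0%R j * h j x)%R.

Definition penalized_risk (P : probability S R) (eps : R) lam : \bar R :=
  L2norm (mixture lam) ^+ 2 - 2%:E * \int[P]_x (mixture lam x)%:E
  + (eps * neg_entropy lam)%:E.

(* Orientation: u ranges over MINUS the tangent cone, i.e. over the positive
   multiples of lam - lam' with lam' in Lam.  These are the directions whose
   pairing with w enters the first-order optimality condition of the
   penalized problem; with u in the tangent cone itself, the oracle inequality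
   fails at vertices of the simplex.
   The supremum is taken in \bar R, so it is -oo over the empty set, which
   occurs exactly when all the mixtures lam' in Lam coincide mu-a.e.; then the
   square of the coefficient is +oo. *)
Definition align_coef (Lam : set 'rV[R]_N) lam w : \bar R :=
  ereal_sup [set (dotp w u)%:E | u in
    [set u | tangent_cone Lam lam (- u)%R /\ L2norm (mixture u) = 1]].

Definition alphaN lam : \bar R := align_coef simplex lam (sN lam).

End Dictionary.
End Densities.

(* Main.v *)
(* Up to the constant |f_*|^2 the penalized risk is |f_lam - f_*|^2 plus eps
   times the negative entropy.  Write nu for its minimizer and u = lam - nu.
   Minimality is only tested against the midpoint m = (lam + nu) / 2: by the
   parallelogram identity,
     |f_m - f_*|^2 = (|f_lam - f_*|^2 + |f_nu - f_*|^2) / 2 - |f_u|^2 / 4,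
   and by convexity of x log x the entropy changes by at most half of
     <s^N(lam), u> - sum_(j notin supp lam) nu_j + 2 / N,
   so that no derivative of the risk (singular on the faces of the simplex) is
   needed.  Finally <s^N(lam), u> <= |alpha_N(lam)| |f_u|, and the resulting
   cross term is absorbed by |f_u|^2. *)
Require Import Defs.
From HB Require Import structures.
From mathcomp Require Import all_boot all_order all_algebra.
From mathcomp Require Import all_classical all_reals all_analysis.
From mathcomp Require Import measurable_realfun ring lra.

Set Implicit Arguments.
Unset Strict Implicit.
Import Order.TTheory GRing.Theory Num.Theory.
Import numFieldNormedType.Exports.
Local Open Scope classical_set_scope.
Local Open Scope ring_scope.

(** * Convexity of [t ln t] and the entropy at a midpoint *)

Lemma mulr_ln_ge_subr1 (R : realType) (y : R) : 0 <= y -> y - 1 <= y * ln y.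
Proof.
rewrite le_eqVlt => /orP[/eqP <-|y0]; first by lra.
have := @le_ln1Dx R (y^-1 - 1).
rewrite addrCA subrr addr0 lnV ?posrE// ltrBDl subrr invr_gt0 => /(_ y0) h.
have : y * - ln y <= y * (y^-1 - 1) by rewrite ler_pM2l.
rewrite mulrBr mulfV ?gt_eqF//; lra.
Qed.

(** By convexity of [t ln t], its tangent at [y] stays below the graph; this is the previous bound
    at [x / y], scaled by [y]. *)
Lemma mulr_ln_tangent (R : realType) (x y : R) : 0 <= x -> 0 < y ->
  y * ln y - x * ln x <= (y - x) * (ln y + 1).
Proof.
rewrite le_eqVlt => /orP[/eqP <-|x0] y0; first by lra.
have xy0 : 0 < x / y by rewrite divr_gt0.
have yxy : y * (x / y) = x by rewrite mulrC divfK ?gt_eqF.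
have : y * (x / y - 1) <= y * (x / y * ln (x / y)).
  by rewrite ler_pM2l// mulr_ln_ge_subr1// ltW.
rewrite ln_div ?posrE// mulrBr mulrA yxy; lra.
Qed.

(* For l = 0 the term 2 / N^2 pays for the factor log N^2 put on the
   coordinates outside the support, because N^2 m log (N^2 m) >= -1. *)
Lemma entropy_term_midpoint (R : realType) (N : nat) (l n m : R) :
    (0 < N)%N -> 0 <= l -> 0 <= n -> m = (l + n) / 2 ->
  m * ln m - n * ln n <=
  2^-1 * ((if l != 0 then ln (expR 1 * N%:R ^+ 2 * l) else 0) * (l - n)
          - ln (N%:R ^+ 2) * (l - n)
          - (if l != 0 then 0 else n) + 2 / N%:R ^+ 2).
Proof.
move=> N0 l0 n0 m_def.
have N20 : 0 < N%:R ^+ 2 :> R by rewrite exprn_gt0// ltr0n.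
have c0 : 0 <= 2 / N%:R ^+ 2 :> R by rewrite divr_ge0// ltW.
case: (eqVneq l 0) => /= [l_eq0|l_neq0].
  have [n_eq0|n_neq0] := eqVneq n 0.
    by rewrite m_def l_eq0 n_eq0 !(addr0, mul0r, subr0, mulr0); lra.
  have n_gt0 : 0 < n by rewrite lt_neqAle eq_sym n_neq0.
  have m0 : 0 < m by rewrite m_def l_eq0; lra.
  have := mulr_ln_tangent n0 m0.
  have y0 : 0 <= N%:R ^+ 2 * m by rewrite mulr_ge0// ltW.
  have := mulr_ln_ge_subr1 y0; rewrite lnM ?posrE// => hy.
  have : m * (ln (N%:R ^+ 2) + ln m) >= m - (N%:R ^+ 2)^-1.
    rewrite -(ler_pM2l N20) mulrBr mulfV ?gt_eqF//.
    by rewrite [leRHS]mulrA.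
  have -> : n = 2 * m by rewrite m_def l_eq0; field.
  rewrite l_eq0; lra.
have l_gt0 : 0 < l by rewrite lt_neqAle eq_sym l_neq0.
have m0 : 0 < m by rewrite m_def; lra.
apply: le_trans (mulr_ln_tangent n0 m0) _.
have -> : ln (expR 1 * N%:R ^+ 2 * l) = 1 + ln (N%:R ^+ 2) + ln l.
  have eN : 0 < expR 1 * N%:R ^+ 2 :> R by rewrite mulr_gt0 ?expR_gt0.
  by rewrite (lnM eN l_gt0) (lnM (expR_gt0 1) N20) expRK.
have mn : m - n = 2^-1 * (l - n) by rewrite m_def; field.
(* Since [m] lies between [l] and [n], [ln l - ln m] never has the sign opposite to [l - n]. *)
have : (l - n) * ln m <= (l - n) * ln l.
  have [ln_le|/ltW ln_le] := leP l n.
    by rewrite ler_wnM2l ?subr_le0// ler_ln ?posrE// m_def; lra.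
  by rewrite ler_wpM2l ?subr_ge0// ler_ln ?posrE// m_def; lra.
rewrite mn; lra.
Qed.

Lemma simplex_dim_gt0 (R : realType) (N : nat) (lam : 'rV[R]_N) :
  simplex lam -> (0 < N)%N.
Proof.
case: N lam => // lam [_]; rewrite big_ord0 => /esym/eqP.
by rewrite oner_eq0.
Qed.

Lemma neg_entropy_midpoint (R : realType) (N : nat) (lam nu : 'rV[R]_N) :
    simplex lam -> simplex nu ->
  neg_entropy (nu + 2^-1 *: (lam - nu)) - neg_entropy nu <=
  2^-1 * (dotp (sN lam) (lam - nu)
          - \sum_(j < N | j \notin supp lam) nu 0 j + 2 / N%:R).
Proof.
move=> slam snu; have N0 := simplex_dim_gt0 slam.
case: slam snu => lam0 lam1 [nu0 nu1].
rewrite /neg_entropy -sumrB.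
have N_neq0 : N%:R != 0 :> R by rewrite pnatr_eq0 -lt0n.
have -> : 2 / N%:R = \sum_(j < N) (2 / N%:R ^+ 2) :> R.
  by rewrite sumr_const card_ord -mulr_natr; field.
(* Both points have coordinate sum 1, so the inserted multiples of [ln (N ^ 2)] cancel in total;
   they bring each summand to the form of the coordinatewise bound. *)
have -> : dotp (sN lam) (lam - nu) = \sum_(j < N)
    (sN lam 0 j * (lam - nu) 0 j - ln (N%:R ^+ 2) * (lam 0 j - nu 0 j)).
  by rewrite sumrB -mulr_sumr sumrB lam1 nu1 subrr mulr0 subr0.
rewrite [X in _ - X + _]big_mkcond /= -sumrB -big_split mulr_sumr.
apply: ler_sum => j _ /=.
have := entropy_term_midpoint N0 (lam0 j) (nu0 j) erefl.
rewrite /supp !mxE unfold_in /=.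
have -> : nu 0 j + 2^-1 * (lam 0 j - nu 0 j) = (lam 0 j + nu 0 j) / 2 by field.
by case: eqP => _.
Qed.

(** * Bounded integrable functions and their L2 norms *)

Section BoundedIntegrable.
Context {d : measure_display} {S : measurableType d} {R : realType}.
Variable mu : {measure set S -> \bar R}.
Implicit Types f g : S -> R.

(** Unlike integrability alone, this class is closed under products, so every squared norm and inner
    product below is a finite real integral. *)
Definition bounded_integrable f :=
  (exists M, forall x, `|f x| <= M) /\ mu.-integrable setT (EFin \o f).

Lemma bounded_integrable_density f (M : R) :
  is_density mu f -> (forall x, f x <= M) -> bounded_integrable f.
Proof.
move=> [mf f0 f1] fM; split; first by exists M => x; rewrite ger0_norm.
apply/integrableP; split; first exact/measurable_EFinP.
under eq_integral do rewrite /= ger0_norm//.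
by rewrite f1 ltry.
Qed.

Lemma bounded_integrable_measurable f :
  bounded_integrable f -> measurable_fun setT f.
Proof. by move=> [_ /measurable_int/measurable_EFinP]. Qed.

Lemma bounded_integrable_bounded f :
  bounded_integrable f -> [bounded f x | x in setT].
Proof.
move=> [[M fM] _]; exists M; split; first exact: num_real.
by move=> r Mr x _ /=; rewrite (le_trans (fM x))// ltW.
Qed.

Lemma bounded_integrable0 : bounded_integrable (fun=> 0).
Proof.
by split; [exists 0 => x; rewrite normr0 | exact: integrable0].
Qed.

Lemma bounded_integrableD f g :
  bounded_integrable f -> bounded_integrable g ->
  bounded_integrable (fun x => f x + g x).
Proof.
move=> [[M fM] f_int] [[M' gM'] g_int]; split.
  by exists (M + M') => x; rewrite (le_trans (ler_normD _ _))// lerD.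
exact: (integrableD measurableT f_int g_int).
Qed.

Lemma bounded_integrableM f g :
  bounded_integrable f -> bounded_integrable g ->
  bounded_integrable (fun x => f x * g x).
Proof.
move=> bf bg; split; last first.
  exact: (integrableMr measurableT (bounded_integrable_measurable bf)
    (bounded_integrable_bounded bf) bg.2).
have [[[M fM] _] [[M' gM'] _]] := (bf, bg).
by exists (M * M') => x; rewrite normrM ler_pM.
Qed.

Lemma bounded_integrableZ k f :
  bounded_integrable f -> bounded_integrable (fun x => k * f x).
Proof.
move=> [[M fM] f_int]; split; last exact: (integrableZl measurableT k f_int).
by exists (`|k| * M) => x; rewrite normrM ler_wpM2l.
Qed.

Lemma bounded_integrableB f g :
  bounded_integrable f -> bounded_integrable g ->
  bounded_integrable (fun x => f x - g x).
Proof.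
move=> bif big; have := bounded_integrableD bif (bounded_integrableZ (-1) big).
by congr bounded_integrable; apply/funext => x; rewrite mulN1r.
Qed.

Lemma Rintegral_sqrDZ f g k : bounded_integrable f -> bounded_integrable g ->
  \int[mu]_x (f x + k * g x) ^+ 2 =
  \int[mu]_x (f x ^+ 2) + 2 * k * \int[mu]_x (f x * g x)
  + k ^+ 2 * \int[mu]_x (g x ^+ 2).
Proof.
move=> bf bg.
have bff := bounded_integrableM bf bf.
have bfg := bounded_integrableZ (2 * k) (bounded_integrableM bf bg).
have bgg := bounded_integrableZ (k ^+ 2) (bounded_integrableM bg bg).
rewrite -RintegralZl//; last exact: (bounded_integrableM bf bg).2.
rewrite -RintegralZl//; last exact: (bounded_integrableM bg bg).2.
rewrite -RintegralD//; [|exact: bff.2|exact: bfg.2].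
rewrite -RintegralD//; [|exact: (bounded_integrableD bff bfg).2|exact: bgg.2].
by apply: eq_Rintegral => x _ /=; ring.
Qed.

Lemma L2norm_sqr f : bounded_integrable f ->
  (L2norm mu f ^+ 2 = (\int[mu]_x (f x ^+ 2))%:E)%E.
Proof.
move=> bf; have bff := bounded_integrableM bf bf.
(* The integer square and the real power 2 must also agree at [+oo], as finiteness of the norm is
   not yet known. *)
have norm2 (x : \bar R) : (0 <= x)%E -> (x ^+ 2 = x `^ 2)%E.
  case: x => [r||]// r0; last by rewrite expe2 poweRyr ?mulyy// pnatr_eq0.
  by rewrite poweR_EFin powR_mulrn// EFin_expe.
rewrite norm2 ?Lnorm_ge0// /L2norm poweR_Lnorm// /Rintegral fineK; last first.
  exact: integrable_fin_num bff.2.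
apply: eq_integral => x _ /=.
by rewrite powR_mulrn// -normrX ger0_norm// sqr_ge0.
Qed.

Lemma L2norm_eq1 f : bounded_integrable f ->
  \int[mu]_x (f x ^+ 2) = 1 -> L2norm mu f = 1%E.
Proof.
move=> /L2norm_sqr fE int1; move: fE; rewrite int1.
have : (0 <= L2norm mu f)%E by exact: Lnorm_ge0.
case: (L2norm mu f) => [r||]//.
rewrite lee_fin -EFin_expe => r0 [] /eqP.
by rewrite sqrf_eq1 => /orP[/eqP->//|/eqP r1]; move: r0; rewrite r1 ler0N1.
Qed.

End BoundedIntegrable.

(** * Expectation under [P] as an integral against its density *)

Lemma integral_has_density {d : measure_display} {S : measurableType d}
    {R : realType} (mu : {sigma_finite_measure set S -> \bar R})
    (P : probability S R) (fstar g : S -> R) :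
    has_density mu P fstar -> measurable_fun setT g -> [bounded g x | x in setT] ->
  (\int[P]_x (g x)%:E = \int[mu]_x (g x * fstar x)%:E)%E.
Proof.
move=> [[mf f0 f1] Pf] mg bg.
have Pmu : P `<< mu.
  apply/null_content_dominatesP => A mA muA0; rewrite Pf//.
  by apply: null_set_integral => //; exact/measurable_funTS/measurable_EFinP.
rewrite -(Radon_Nikodym_change_of_variables Pmu)//=; last first.
  apply: (@measurable_bounded_integrable _ _ _ P) => //.
  by rewrite (le_lt_trans (probability_le1 P measurableT))// ltry.
apply: ae_eq_integral => //.
- apply: emeasurable_funM => //; exact/measurable_EFinP.
- by apply/measurable_EFinP; exact: measurable_funM.
under [X in ae_eq _ _ _ X]eq_fun do rewrite EFinM.
apply: ae_eqe_mul2l => /=.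
(* Uniqueness of densities: [fstar] and the Radon-Nikodym derivative both integrate to [P A] over
   each measurable [A]. *)
apply: integral_ae_eq => //=.
- by apply: Radon_Nikodym_integrable; exact: Pmu.
- exact/measurable_EFinP.
- by move=> A _ mA; rewrite -Pf// -Radon_Nikodym_integral.
Qed.

(** * Segments in the simplex and linearity of the pairing *)

Lemma simplex_convex (R : realType) (N : nat) (lam nu : 'rV[R]_N) (t : R) :
  simplex lam -> simplex nu -> 0 <= t <= 1 -> simplex (nu + t *: (lam - nu)).
Proof.
move=> [lam0 lam1] [nu0 nu1] /andP[t0 t1]; split => [j|].
  have := mulr_ge0 t0 (lam0 j); have : 0 <= (1 - t) * nu 0 j.
    by rewrite mulr_ge0// subr_ge0.
  by rewrite !mxE; lra.
under eq_bigr do rewrite !mxE.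
by rewrite big_split -mulr_sumr sumrB/= lam1 nu1 subrr mulr0 addr0.
Qed.

Lemma dotpDZ (R : realType) (N : nat) (w u v : 'rV[R]_N) (k : R) :
  dotp w (u + k *: v) = dotp w u + k * dotp w v.
Proof.
rewrite /dotp mulr_sumr -big_split; apply: eq_bigr => j _ /=.
by rewrite !mxE; ring.
Qed.

Lemma dotpZ (R : realType) (N : nat) (w u : 'rV[R]_N) (k : R) :
  dotp w (k *: u) = k * dotp w u.
Proof.
by rewrite /dotp mulr_sumr; apply: eq_bigr => j _; rewrite mxE mulrCA.
Qed.

(** * The quadratic form of mixtures and the alignment coefficient *)

Section Mixtures.
Context {d : measure_display} {S : measurableType d} {R : realType}.
Variables (mu : {measure set S -> \bar R}) (N : nat) (h : 'I_N -> S -> R).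
Hypothesis h_bi : forall j, bounded_integrable mu (h j).
Implicit Types lam u v w : 'rV[R]_N.

Lemma mixtureDZ lam u k x :
  mixture h (lam + k *: u) x = mixture h lam x + k * mixture h u x.
Proof.
rewrite /mixture mulr_sumr -big_split; apply: eq_bigr => j _ /=.
by rewrite !mxE; ring.
Qed.

Lemma bounded_integrable_mixture lam : bounded_integrable mu (mixture h lam).
Proof.
rewrite /mixture; elim: (index_enum _) => [|j s ih].
  by under eq_fun do rewrite big_nil; exact: bounded_integrable0.
under eq_fun do rewrite big_cons.
by apply: bounded_integrableD => //; exact: bounded_integrableZ.
Qed.

Let sqnorm u := \int[mu]_x (mixture h u x) ^+ 2.
Let inner u v := \int[mu]_x (mixture h u x * mixture h v x).

Let sqnorm_ge0 u : 0 <= sqnorm u.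
Proof. by apply: Rintegral_ge0 => x _; exact: sqr_ge0. Qed.

Let sqnormDZ u v k :
  sqnorm (u + k *: v) = sqnorm u + 2 * k * inner u v + k ^+ 2 * sqnorm v.
Proof.
rewrite -Rintegral_sqrDZ; [|exact: bounded_integrable_mixture..].
by apply: eq_Rintegral => x _; rewrite mixtureDZ.
Qed.

Let sqnormZ u k : sqnorm (k *: u) = k ^+ 2 * sqnorm u.
Proof.
have -> : k *: u = u + (k - 1) *: u by rewrite scalerBl scale1r addrC subrK.
by rewrite sqnormDZ -[inner u u]/(sqnorm u); ring.
Qed.

(** For null [v], the squared norm of [u + k v] is affine in [k]; a nonzero slope would let it reach
    -1, which the chosen [k] does. *)
Let inner_eq0 u v : sqnorm v = 0 -> inner u v = 0.
Proof.
move=> v0; apply/eqP/negPn/negP => uv0.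
have := sqnorm_ge0 (u + (- (sqnorm u + 1) / (2 * inner u v)) *: v).
rewrite sqnormDZ v0 mulr0 addr0.
have -> : 2 * (- (sqnorm u + 1) / (2 * inner u v)) * inner u v =
  - (sqnorm u + 1) by field.
by lra.
Qed.

(** If [lam - nu] has positive norm, normalizing it gives an admissible direction. If it is null,
    its pairing with [w] must be shown nonpositive, which uses finiteness of the supremum. *)
Lemma dotp_le_align_coef (lam nu w : 'rV[R]_N) (a : R) :
    simplex lam -> simplex nu -> align_coef mu h simplex lam w = a%:E ->
  dotp w (lam - nu) <=
  `|a| * Num.sqrt (\int[mu]_x (mixture h (lam - nu) x) ^+ 2).
Proof.
move=> slam snu aE; rewrite -/(sqnorm _).
have dotp_le u : tangent_cone simplex lam (- u) -> sqnorm u = 1 ->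
    dotp w u <= a.
  move=> Tu u1; rewrite -lee_fin -aE; apply: ereal_sup_ubound; exists u => //.
  by split => //; apply: L2norm_eq1 => //; exact: bounded_integrable_mixture.
set u := lam - nu.
have [u_gt0|] := ltP 0 (sqnorm u).
  have c_gt0 : 0 < Num.sqrt (sqnorm u) by rewrite sqrtr_gt0.
  have := dotp_le ((Num.sqrt (sqnorm u))^-1 *: u).
  rewrite dotpZ sqnormZ exprVn sqr_sqrtr// mulVf ?gt_eqF// mulrC.
  rewrite ler_pdivrMr// => h1.
  have /h1/(_ erefl)/le_trans : tangent_cone simplex lam
      (- ((Num.sqrt (sqnorm u))^-1 *: u)).
    (* A step of this length from [lam] along the opposite of the normalized direction lands exactly
       on [nu]. *)
    exists (Num.sqrt (sqnorm u)) => //.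
    by rewrite scalerN scalerA mulfV ?gt_eqF// scale1r /u subKr.
  by apply; rewrite ler_wpM2r ?sqrtr_ge0// ler_norm.
move=> u_le0; have u0 : sqnorm u = 0 by apply/eqP; rewrite eq_le u_le0 sqnorm_ge0.
rewrite u0 sqrtr0 mulr0.
(* A null direction u can be added to any unit direction v without changing
   its norm, so the supremum would be infinite were <w, u> positive. *)
have [v [Tv v1]] : exists v, tangent_cone simplex lam (- v) /\
    L2norm mu (mixture h v) = 1%E.
  (* With no unit direction the supremum would be [-oo], not the real [a]. *)
  apply: contrapT => nov; move: aE; rewrite /align_coef.
  rewrite (_ : [set _ | _ in _] = set0) ?ereal_sup0//.
  by rewrite -subset0 => ? [v Tv _]; apply: nov; exists v.
have v1' : sqnorm v = 1.
  apply/EFin_inj; rewrite /sqnorm -L2norm_sqr; first by rewrite v1 expe2 mule1.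
  exact: bounded_integrable_mixture.
have ray k : 0 <= k -> dotp w v + k * dotp w u <= a.
  move=> k0; rewrite -dotpDZ; apply: dotp_le; last first.
    by rewrite sqnormDZ v1' u0 inner_eq0// !mulr0 !addr0.
  case: Tv => t t0 sv.
  have kt0 : 0 < 1 + k * t by rewrite ltr_pwDl// mulr_ge0// ltW.
  (* This step reaches the convex combination of [nu] and [lam - t v] with weights [k t / (1 + k t)]
     and [1 / (1 + k t)]. *)
  exists (t / (1 + k * t)); first by rewrite divr_gt0.
  have -> : lam + t / (1 + k * t) *: - (v + k *: u) =
      nu + (1 + k * t)^-1 *: ((lam + t *: - v) - nu).
    apply/rowP => j; rewrite !mxE; field.
    by rewrite gt_eqF.
  apply: simplex_convex => //.
  by rewrite invr_ge0 ltW//= invf_le1// lerDl mulr_ge0// ltW.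
rewrite leNgt; apply/negP => wu0.
(* This [k] makes the left side of [ray] at least [|a| + 1]. *)
have := ray ((`|a| + `|dotp w v| + 1) / dotp w u).
rewrite divfK ?gt_eqF// => /(_ _)/wrap[].
  by rewrite divr_ge0 ?addr_ge0// ltW.
have := ler_norm a; have := ler_norm (- dotp w v); rewrite normrN.
lra.
Qed.

End Mixtures.

(** * The penalized risk as a squared distance, and its minimality *)

Lemma penalized_riskE {d : measure_display} {S : measurableType d}
    {R : realType} (mu : {sigma_finite_measure set S -> \bar R})
    (P : probability S R) (fstar : S -> R) (N : nat) (h : 'I_N -> S -> R)
    (eps : R) (lam : 'rV[R]_N) :
    has_density mu P fstar -> bounded_integrable mu fstar ->
    (forall j, bounded_integrable mu (h j)) ->
  penalized_risk mu h P eps lam =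
  (\int[mu]_x (mixture h lam x - fstar x) ^+ 2 - \int[mu]_x (fstar x ^+ 2)
   + eps * neg_entropy lam)%:E.
Proof.
move=> Pf bf bh; have bm := bounded_integrable_mixture bh lam.
rewrite /penalized_risk L2norm_sqr// (integral_has_density Pf); last 2 first.
- exact: bounded_integrable_measurable bm.
- exact: bounded_integrable_bounded bm.
rewrite -[in X in (_ - X + _)%E](@fineK _ (\int[mu]_x _)%E); last first.
  exact: integrable_fin_num (bounded_integrableM bm bf).2.
rewrite -[fine _]/(\int[mu]_x (mixture h lam x * fstar x)).
rewrite -EFinM -EFinB -EFinD; congr (_ + _)%:E.
(* The quadratic expansion with coefficient -1 completes the square. *)
have -> : \int[mu]_x (mixture h lam x - fstar x) ^+ 2 =
    \int[mu]_x (mixture h lam x + -1 * fstar x) ^+ 2.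
  by apply: eq_Rintegral => x _; rewrite mulN1r.
by rewrite Rintegral_sqrDZ//; ring.
Qed.

Lemma argmin_penalized_risk_le {d : measure_display} {S : measurableType d}
    {R : realType} (mu : {sigma_finite_measure set S -> \bar R})
    (P : probability S R) (fstar : S -> R) (N : nat) (h : 'I_N -> S -> R)
    (eps : R) (lam nu : 'rV[R]_N) :
    has_density mu P fstar -> bounded_integrable mu fstar ->
    (forall j, bounded_integrable mu (h j)) -> 0 <= eps ->
    argmin (penalized_risk mu h P eps) simplex nu -> simplex lam ->
  2 * \int[mu]_x (mixture h nu x - fstar x) ^+ 2
    + \int[mu]_x (mixture h (lam - nu) x) ^+ 2
    + 2 * eps * \sum_(j < N | j \notin supp lam) nu 0 j
  <= 2 * \int[mu]_x (mixture h lam x - fstar x) ^+ 2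
    + 2 * eps * dotp (sN lam) (lam - nu) + 4 * (eps / N%:R).
Proof.
move=> Pf bf bh eps0 [snu nu_min] slam.
set mid := nu + 2^-1 *: (lam - nu).
have /nu_min : simplex mid by apply: simplex_convex => //; lra.
rewrite !(penalized_riskE _ _ Pf bf bh) lee_fin.
have bnu := bounded_integrableB (bounded_integrable_mixture bh nu) bf.
have bu := bounded_integrable_mixture bh (lam - nu).
(* Used at [k = 1/2] for [mid] and at [k = 1] for [lam]; eliminating the cross integral between the
   two gives the parallelogram identity. *)
have expand k : \int[mu]_x (mixture h (nu + k *: (lam - nu)) x - fstar x) ^+ 2 =
    \int[mu]_x (mixture h nu x - fstar x) ^+ 2
    + 2 * k * \int[mu]_x ((mixture h nu x - fstar x) * mixture h (lam - nu) x)
    + k ^+ 2 * \int[mu]_x (mixture h (lam - nu) x) ^+ 2.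
  rewrite -Rintegral_sqrDZ//; apply: eq_Rintegral => x _.
  by rewrite mixtureDZ addrAC.
rewrite expand; have := expand 1; rewrite scale1r addrC subrK => ->.
have := ler_wpM2l eps0 (neg_entropy_midpoint slam snu); rewrite -/mid.
lra.
Qed.

(** * The oracle inequality *)

Theorem theorem7 (R : realType) :
  exists2 C : R, 0 < C &
  forall (d : measure_display) (S : measurableType d)
    (mu : {sigma_finite_measure set S -> \bar R})
    (P : probability S R) (fstar : S -> R) (M : R)
    (N : nat) (h : 'I_N -> S -> R),
    has_density mu P fstar ->
    (forall x, fstar x <= M) ->
    (forall j, is_density mu (h j)) ->
    (forall j x, h j x <= 1) ->
  forall (eps : R) (lameps lam : 'rV[R]_N),
    0 < eps ->
    argmin (penalized_risk mu h P eps) simplex lameps ->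
    simplex lam ->
  (L2norm mu (fun x => mixture h lameps x - fstar x)%R ^+ 2
     + (2 * eps * \sum_(j < N | j \notin supp lam) lameps ord0 j)%:E
   <= 3%:E * L2norm mu (fun x => mixture h lam x - fstar x)%R ^+ 2
     + C%:E * ((eps ^+ 2)%:E * alphaN mu h lam ^+ 2 + (eps / N%:R)%:E))%E.
Proof.
(* The value 4 is the coefficient of [eps / N] in the midpoint inequality; the alignment term costs
   only a factor 1. *)
exists 4; first by [].
move=> d S mu P fstar M N h Pf fM hd h1 eps nu lam eps0 nu_min slam.
have bf := bounded_integrable_density Pf.1 fM.
have bh j := bounded_integrable_density (hd j) (h1 j).
have bm l := bounded_integrableB (bounded_integrable_mixture bh l) bf.
rewrite !L2norm_sqr//.
(* An infinite coefficient of either sign has square [+oo], and [eps ^ 2 > 0] keeps the right side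
   infinite. *)
have infinite_rhs (A B D : R) :
    (A%:E <= 3%:E * B%:E + 4%:E * ((eps ^+ 2)%:E * +oo + D%:E))%E.
  rewrite gt0_muley ?lte_fin ?exprn_gt0// addye// gt0_muley ?lte_fin//.
  by rewrite addey// leey.
have := argmin_penalized_risk_le Pf bf bh (ltW eps0) nu_min slam.
case aE : (alphaN mu h lam) => [a||]; last 2 first.
- by move=> _; rewrite expe2 mulyy -EFinD; exact: infinite_rhs.
- by move=> _; rewrite expe2 mulNyNy -EFinD; exact: infinite_rhs.
have := dotp_le_align_coef bh slam nu_min.1 aE.
rewrite -EFin_expe -!EFinM -!EFinD lee_fin.
set D := \int[mu]_x (mixture h (lam - nu) x) ^+ 2.
set A := \int[mu]_x (mixture h nu x - fstar x) ^+ 2.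
set B := \int[mu]_x (mixture h lam x - fstar x) ^+ 2.
have A0 : 0 <= A by apply: Rintegral_ge0 => x _; exact: sqr_ge0.
have B0 : 0 <= B by apply: Rintegral_ge0 => x _; exact: sqr_ge0.
have D0 : 0 <= D by apply: Rintegral_ge0 => x _; exact: sqr_ge0.
move=> /(ler_wpM2l (ltW eps0)).
(* This square gives [2 eps |a| sqrt D <= D + eps^2 a^2], and [D] cancels against the left side of
   the midpoint inequality. What remains has [2 A] and [2 B]; nonnegativity of [A], [B] and
   [eps^2 a^2] relaxes it to the claim. *)
have := sqr_ge0 (Num.sqrt D - eps * `|a|).
have -> : (Num.sqrt D - eps * `|a|) ^+ 2 =
    D - 2 * (eps * (`|a| * Num.sqrt D)) + eps ^+ 2 * a ^+ 2.
  by rewrite sqrrB sqr_sqrtr// exprMn real_normK ?num_real//; ring.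
have := mulr_ge0 (sqr_ge0 eps) (sqr_ge0 a).
lra.
Qed.
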